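(* Let $\mathsf{k}$ be a field and let $n\ge 1$ be an integer. Let $L_n$ be the Leavitt path algebra over $\mathsf{k}$ of the graph with one vertex and $n$ loops, and let $L_{n_-}$ be the Leavitt path algebra over $\mathsf{k}$ of the Cuntz splice of this graph, that is, of the graph on three vertices with adjacency matrix $\begin{pmatrix} n&1&0\\1&1&1\\0&1&1\end{pmatrix}$. Then there are no unital graded ring homomorphisms $L_n\to L_{n_-}$, and there are no unital graded ring homomorphisms $L_{n_-}\to L_n$.
   Context: A directed graph is $E=(E^0,E^1,r,s)$ with range and source maps $r,s:E^1\to E^0$; its adjacency matrix has $(v,w)$ entry the number of edges $e$ with $s(e)=v$, $r(e)=w$. For a finite graph $E$, the Leavitt path algebra $L_{\mathsf{k}}(E)$ is the universal $\mathsf{k}$-algebra generated by $\{v:v\in E^0\}\cup\{e,e^*:e\in E^1\}$ subject to: $v^2=v$, $vw=0$ for distinct $v,w\in E^0$; $s(e)e=e\,r(e)=e$, $r(e)e^*=e^*s(e)=e^*$; $e^*e=r(e)$ and $e^*f=0$ for distinct edges $e\ne f$; $v=\sum_{s(e)=v}ee^*$ for every $v$ that is not a sink (a sink being a vertex emitting no edge). It is $\mathbb{Z}$-graded by $\deg v=0$, $\deg e=1$, $\deg e^*=-1$. Graded ring homomorphisms preserve this $\mathbb{Z}$-grading. *)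

(* Defs.v *)
From HB Require Import structures.
From mathcomp Require Import all_boot all_order all_algebra.
From mathcomp Require Import boolp.

Set Implicit Arguments.
Unset Strict Implicit.
Unset Printing Implicit Defensive.

Import GRing.Theory.
Local Open Scope ring_scope.

Record fgraph := FGraph {
  vertex : finType;
  edge : finType;
  src : edge -> vertex;
  rng : edge -> vertex }.

Definition is_sink (E : fgraph) (v : vertex E) : Prop :=
  forall e : edge E, src e <> v.

Definition adjacency (E : fgraph) (v w : vertex E) : nat :=
  #|[set e : edge E | (src e == v) && (rng e == w)]|.

(* The edges from v to w are the (v, w, i) with i < A v w. *)
Definition graph_of_adj (m : nat) (A : 'M[nat]_m) : fgraph :=
  @FGraph 'I_m {vw : 'I_m * 'I_m & 'I_(A vw.1 vw.2)}
    (fun e => (tag e).1) (fun e => (tag e).2).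

Lemma adjacency_graph_of_adj (m : nat) (A : 'M[nat]_m) (v w : 'I_m) :
  @adjacency (graph_of_adj A) v w = A v w.
Proof.
rewrite /adjacency.
pose h (i : 'I_(A v w)) : edge (graph_of_adj A) :=
  existT (fun vw : 'I_m * 'I_m => 'I_(A vw.1 vw.2)) (v, w) i.
have hI : injective h by move=> i j /eqP; rewrite eq_Tagged => /eqP.
rewrite -[RHS]card_ord -(card_imset _ hI); apply: eq_card => e.
rewrite inE; apply/andP/imsetP => [|[i _ ->] //].
by case: e => -[a b] i [/= /eqP av /eqP bw]; subst a b; exists i.
Qed.

Definition rose (n : nat) : fgraph :=
  @FGraph unit 'I_n (fun _ => tt) (fun _ => tt).

Definition cuntz_splice_matrix (n : nat) : 'M[nat]_3 :=
  \matrix_(i, j)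
    nth 0%N (nth [::] [:: [:: n; 1; 0]; [:: 1; 1; 1]; [:: 0; 1; 1]]%N i) j.

Definition rose_splice (n : nat) : fgraph :=
  graph_of_adj (cuntz_splice_matrix n).

Inductive lgen (E : fgraph) :=
  | GV of vertex E
  | GE of edge E
  | GS of edge E.   (* the ghost edge e^* *)

(* Terms in the signature of k-algebras without unit: the vertices are not
   required a priori to sum up to a unit, this is proved below. *)
Inductive lterm (k : Type) (E : fgraph) :=
  | TGen of lgen E
  | TZero
  | TOpp of lterm k E
  | TAdd of lterm k E & lterm k E
  | TScale of k & lterm k E
  | TMul of lterm k E & lterm k E.

Arguments TGen {k E}.
Arguments TZero {k E}.

Section Congruence.
Variables (k : fieldType) (E : fgraph).

Local Notation tvert v := (TGen (GV v)).
Local Notation tedge e := (TGen (GE e)).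
Local Notation tstar e := (TGen (GS e)).
Local Infix "+t" := (@TAdd k E) (at level 50, left associativity).
Local Infix "*t" := (@TMul k E) (at level 40, left associativity).
Local Infix "*:t" := (@TScale k E) (at level 40).

Inductive lcong : lterm k E -> lterm k E -> Prop :=
  | lc_refl x : lcong x x
  | lc_sym x y : lcong x y -> lcong y x
  | lc_trans x y z : lcong x y -> lcong y z -> lcong x z
  | lc_opp x y : lcong x y -> lcong (TOpp x) (TOpp y)
  | lc_add x x' y y' : lcong x x' -> lcong y y' -> lcong (x +t y) (x' +t y')
  | lc_scale a x y : lcong x y -> lcong (a *:t x) (a *:t y)
  | lc_mul x x' y y' : lcong x x' -> lcong y y' -> lcong (x *t y) (x' *t y')
  | lc_addA x y z : lcong (x +t (y +t z)) (x +t y +t z)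
  | lc_addC x y : lcong (x +t y) (y +t x)
  | lc_add0 x : lcong (TZero +t x) x
  | lc_addN x : lcong (TOpp x +t x) TZero
  | lc_scaleA a b x : lcong (a *:t (b *:t x)) ((a * b) *:t x)
  | lc_scale1 x : lcong (1 *:t x) x
  | lc_scaleDr a x y : lcong (a *:t (x +t y)) (a *:t x +t a *:t y)
  | lc_scaleDl a b x : lcong ((a + b) *:t x) (a *:t x +t b *:t x)
  | lc_mulA x y z : lcong (x *t (y *t z)) (x *t y *t z)
  | lc_mulDl x y z : lcong ((x +t y) *t z) (x *t z +t y *t z)
  | lc_mulDr x y z : lcong (x *t (y +t z)) (x *t y +t x *t z)
  | lc_scaleAl a x y : lcong (a *:t (x *t y)) ((a *:t x) *t y)
  | lc_scaleAr a x y : lcong (a *:t (x *t y)) (x *t (a *:t y))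
  | lc_vv v : lcong (tvert v *t tvert v) (tvert v)
  | lc_vw v w : v <> w -> lcong (tvert v *t tvert w) TZero
  | lc_se e : lcong (tvert (src e) *t tedge e) (tedge e)
  | lc_er e : lcong (tedge e *t tvert (rng e)) (tedge e)
  | lc_rs e : lcong (tvert (rng e) *t tstar e) (tstar e)
  | lc_ss e : lcong (tstar e *t tvert (src e)) (tstar e)
  | lc_ee e : lcong (tstar e *t tedge e) (tvert (rng e))
  | lc_ef e f : e <> f -> lcong (tstar e *t tedge f) TZero
  | lc_sum v : ~ is_sink v ->
      lcong (tvert v)
        (\big[@TAdd k E/TZero]_(e | src e == v) (tedge e *t tstar e)).

End Congruence.

HB.instance Definition _ (k : Type) (E : fgraph) := gen_eqMixin (lterm k E).
HB.instance Definition _ (k : Type) (E : fgraph) := gen_choiceMixin (lterm k E).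

Section Leavitt.
Variables (k : fieldType) (E : fgraph).
Local Open Scope quotient_scope.

Definition lcongb : rel (lterm k E) := fun x y => `[< lcong x y >].

Lemma lcongb_refl : reflexive lcongb.
Proof. by move=> x; apply/asboolP/lc_refl. Qed.

Lemma lcongb_sym : symmetric lcongb.
Proof. by move=> x y; apply/asboolP/asboolP; apply: lc_sym. Qed.

Lemma lcongb_trans : transitive lcongb.
Proof. by move=> y x z /asboolP xy /asboolP yz; apply/asboolP/(lc_trans xy). Qed.

Canonical lcong_equiv := EquivRel lcongb lcongb_refl lcongb_sym lcongb_trans.

Definition leavitt : Type := {eq_quot lcong_equiv}.
HB.instance Definition _ := Choice.on leavitt.
HB.instance Definition _ := EqQuotient.on leavitt.

Lemma leavitt_eqP (x y : lterm k E) :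
  \pi_leavitt x = \pi_leavitt y <-> lcong x y.
Proof.
split=> [/eqP|H]; first by rewrite piE => /asboolP.
by apply/eqP; rewrite piE; apply/asboolP.
Qed.

Lemma lcong_repr (x : lterm k E) : lcong (repr (\pi_leavitt x)) x.
Proof. by apply/leavitt_eqP; rewrite reprK. Qed.

Definition lzero : leavitt := \pi_leavitt TZero.
Definition lopp (x : leavitt) : leavitt := \pi_leavitt (TOpp (repr x)).
Definition ladd (x y : leavitt) : leavitt := \pi_leavitt (TAdd (repr x) (repr y)).
Definition lscale (a : k) (x : leavitt) : leavitt := \pi_leavitt (TScale a (repr x)).
Definition lmul (x y : leavitt) : leavitt := \pi_leavitt (TMul (repr x) (repr y)).
Definition lgenr (g : lgen E) : leavitt := \pi_leavitt (TGen g).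

Lemma pi_opp x : \pi_leavitt (TOpp x) = lopp (\pi_leavitt x).
Proof. exact/leavitt_eqP/lc_opp/lc_sym/lcong_repr. Qed.

Lemma pi_add x y : \pi_leavitt (TAdd x y) = ladd (\pi_leavitt x) (\pi_leavitt y).
Proof. by apply/leavitt_eqP/lc_add; apply/lc_sym/lcong_repr. Qed.

Lemma pi_scale a x : \pi_leavitt (TScale a x) = lscale a (\pi_leavitt x).
Proof. exact/leavitt_eqP/lc_scale/lc_sym/lcong_repr. Qed.

Lemma pi_mul x y : \pi_leavitt (TMul x y) = lmul (\pi_leavitt x) (\pi_leavitt y).
Proof. by apply/leavitt_eqP/lc_mul; apply/lc_sym/lcong_repr. Qed.

Let piK (x : leavitt) : x = \pi_leavitt (repr x).
Proof. by rewrite reprK. Qed.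

Lemma laddA : associative ladd.
Proof.
move=> x y z; rewrite (piK x) (piK y) (piK z) -!pi_add.
exact/leavitt_eqP/lc_addA.
Qed.

Lemma laddC : commutative ladd.
Proof. by move=> x y; apply/leavitt_eqP/lc_addC. Qed.

Lemma ladd0 : left_id lzero ladd.
Proof. by move=> x; rewrite (piK x) -pi_add; apply/leavitt_eqP/lc_add0. Qed.

Lemma laddN : left_inverse lzero lopp ladd.
Proof. by move=> x; rewrite (piK x) -pi_opp -pi_add; apply/leavitt_eqP/lc_addN. Qed.

HB.instance Definition _ :=
  GRing.isZmodule.Build leavitt laddA laddC ladd0 laddN.

Lemma lscaleA a b x : lscale a (lscale b x) = lscale (a * b) x.
Proof. by rewrite (piK x) -!pi_scale; apply/leavitt_eqP/lc_scaleA. Qed.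

Lemma lscale1 : left_id 1 lscale.
Proof. by move=> x; rewrite (piK x) -pi_scale; apply/leavitt_eqP/lc_scale1. Qed.

Lemma lscaleDr : right_distributive lscale +%R.
Proof.
move=> a x y; rewrite -[+%R]/ladd (piK x) (piK y) -!(pi_scale, pi_add).
exact/leavitt_eqP/lc_scaleDr.
Qed.

Lemma lscaleDl x : {morph lscale^~ x : a b / a + b}.
Proof.
move=> a b /=; rewrite -[RHS]/(ladd _ _) (piK x) -!(pi_scale, pi_add).
exact/leavitt_eqP/lc_scaleDl.
Qed.

HB.instance Definition _ := GRing.Zmodule_isLmodule.Build k leavitt
  lscaleA lscale1 lscaleDr lscaleDl.

Lemma pi_oppZ x : \pi_leavitt (TOpp x) = -1 *: (\pi_leavitt x : leavitt).
Proof. by rewrite scaleN1r; apply: pi_opp. Qed.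

Lemma lmulA : associative lmul.
Proof.
move=> x y z; rewrite (piK x) (piK y) (piK z) -!pi_mul.
exact/leavitt_eqP/lc_mulA.
Qed.

Lemma lmulDl : left_distributive lmul +%R.
Proof.
move=> x y z; rewrite -[+%R]/ladd (piK x) (piK y) (piK z) -!(pi_mul, pi_add).
exact/leavitt_eqP/lc_mulDl.
Qed.

Lemma lmulDr : right_distributive lmul +%R.
Proof.
move=> x y z; rewrite -[+%R]/ladd (piK x) (piK y) (piK z) -!(pi_mul, pi_add).
exact/leavitt_eqP/lc_mulDr.
Qed.

Lemma lscaleAl a (x y : leavitt) : a *: lmul x y = lmul (a *: x) y.
Proof.
change (lscale a (lmul x y) = lmul (lscale a x) y).
rewrite (piK x) (piK y) -!(pi_scale, pi_mul).
exact/leavitt_eqP/lc_scaleAl.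
Qed.

Lemma lscaleAr a (x y : leavitt) : a *: lmul x y = lmul x (a *: y).
Proof.
change (lscale a (lmul x y) = lmul x (lscale a y)).
rewrite (piK x) (piK y) -!(pi_scale, pi_mul).
exact/leavitt_eqP/lc_scaleAr.
Qed.

Lemma leavitt_ind (P : leavitt -> Prop) :
  (forall g, P (lgenr g)) -> P 0 ->
  (forall x y, P x -> P y -> P (x + y)) ->
  (forall a x, P x -> P (a *: x)) ->
  (forall x y, P x -> P y -> P (lmul x y)) ->
  forall x, P x.
Proof.
move=> Pg P0 PD PZ PM x; rewrite (piK x).
elim: (repr x) => {x} [g||x Px|x Px y Py|a x Px|x Px y Py].
- exact: Pg.
- exact: P0.
- by rewrite pi_oppZ; apply: PZ.
- by rewrite pi_add; apply: PD.
- by rewrite pi_scale; apply: PZ.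
- by rewrite pi_mul; apply: PM.
Qed.

(* The Leavitt relations for a family in an algebra (A, mul). *)
Definition leavitt_family (A : nmodType) (mul : A -> A -> A)
    (p : vertex E -> A) (q qs : edge E -> A) : Prop :=
  (forall v, mul (p v) (p v) = p v) /\
  (forall v w, v <> w -> mul (p v) (p w) = 0) /\
  (forall e, mul (p (src e)) (q e) = q e) /\
  (forall e, mul (q e) (p (rng e)) = q e) /\
  (forall e, mul (p (rng e)) (qs e) = qs e) /\
  (forall e, mul (qs e) (p (src e)) = qs e) /\
  (forall e, mul (qs e) (q e) = p (rng e)) /\
  (forall e f, e <> f -> mul (qs e) (q f) = 0) /\
  (forall v, ~ is_sink v -> p v = \sum_(e | src e == v) mul (q e) (qs e)).

Lemma leavitt_gen_family :
  leavitt_family lmul (lgenr \o @GV E) (lgenr \o @GE E) (lgenr \o @GS E).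
Proof.
have sE v : \pi_leavitt (\big[@TAdd k E/TZero]_(e | src e == v)
      TMul (TGen (GE e)) (TGen (GS e))) =
    \sum_(e | src e == v) lmul (lgenr (GE e)) (lgenr (GS e)).
  rewrite (big_morph \pi_leavitt (pi_add : {morph _ : x y / _ >-> x + y}) erefl).
  by apply: eq_bigr => e _; exact: pi_mul.
do 8?[split]; rewrite /= ?/lgenr => *; rewrite -?pi_mul -?sE //;
  apply/leavitt_eqP; by constructor.
Qed.

Definition lone : leavitt := \sum_(v : vertex E) lgenr (GV v).


Lemma lmul0 (x : leavitt) : lmul 0 x = 0.
Proof. by apply: (addrI (lmul 0 x)); rewrite -lmulDl !addr0. Qed.

Lemma lmulr0 (x : leavitt) : lmul x 0 = 0.
Proof. by apply: (addrI (lmul x 0)); rewrite -lmulDr !addr0. Qed.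

Lemma lmul_suml (I : Type) (r : seq I) (P : pred I) (F : I -> leavitt) y :
  lmul (\sum_(i <- r | P i) F i) y = \sum_(i <- r | P i) lmul (F i) y.
Proof.
exact: (big_morph (fun x => lmul x y) (fun a b => lmulDl a b y) (lmul0 y)).
Qed.

Lemma lmul_sumr (I : Type) (r : seq I) (P : pred I) (F : I -> leavitt) y :
  lmul y (\sum_(i <- r | P i) F i) = \sum_(i <- r | P i) lmul y (F i).
Proof. exact: (big_morph (lmul y) (lmulDr y) (lmulr0 y)). Qed.

Lemma lgen_left (g : lgen E) : exists v : vertex E,
  lmul (lgenr (GV v)) (lgenr g) = lgenr g.
Proof.
have [vv [_ [se [_ [rs _]]]]] := leavitt_gen_family.
by case: g => [v|e|e]; [exists v; exact: vv | exists (src e); exact: se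
  | exists (rng e); exact: rs].
Qed.

Lemma lgen_right (g : lgen E) : exists v : vertex E,
  lmul (lgenr g) (lgenr (GV v)) = lgenr g.
Proof.
have [vv [_ [_ [er [_ [ss _]]]]]] := leavitt_gen_family.
by case: g => [v|e|e]; [exists v; exact: vv | exists (rng e); exact: er
  | exists (src e); exact: ss].
Qed.

Lemma lone_mul : left_id lone lmul.
Proof.
have [vv [vw _]] := leavitt_gen_family.
apply: leavitt_ind => [g||x y Hx Hy|a x Hx|x y Hx _].
- have [v <-] := lgen_left g; rewrite lmulA; congr lmul.
  rewrite lmul_suml (bigD1 v) //= vv big1 ?addr0 // => w /eqP wv.
  exact: vw.
- exact: lmulr0.
- by rewrite lmulDr Hx Hy.
- by rewrite -lscaleAr Hx.
- by rewrite lmulA Hx.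
Qed.

Lemma lmul_one : right_id lone lmul.
Proof.
have [vv [vw _]] := leavitt_gen_family.
apply: leavitt_ind => [g||x y Hx Hy|a x Hx|x y _ Hy].
- have [v <-] := lgen_right g; rewrite -lmulA; congr lmul.
  rewrite lmul_sumr (bigD1 v) //= vv big1 ?addr0 // => w /eqP wv.
  by apply: vw => vw'; apply: wv.
- exact: lmul0.
- by rewrite lmulDl Hx Hy.
- by rewrite -lscaleAl Hx.
- by rewrite -lmulA Hy.
Qed.

(* Only a pzRing: for the empty graph the algebra is 0. *)
HB.instance Definition _ := GRing.Zmodule_isPzRing.Build leavitt
  lmulA lone_mul lmul_one lmulDl lmulDr.

Lemma leavitt_oneE : 1 = \sum_(v : vertex E) lgenr (GV v) :> leavitt.
Proof. by []. Qed.

Lemma leavitt_scalerAl (a : k) (x y : leavitt) : a *: (x * y) = (a *: x) * y.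
Proof. exact: lscaleAl. Qed.

Lemma leavitt_scalerAr (a : k) (x y : leavitt) : a *: (x * y) = x * (a *: y).
Proof. exact: lscaleAr. Qed.

Theorem leavitt_universal (A : lmodType k) (mul : A -> A -> A)
    (p : vertex E -> A) (q qs : edge E -> A) :
  associative mul -> left_distributive mul +%R -> right_distributive mul +%R ->
  (forall (a : k) x y, a *: mul x y = mul (a *: x) y) ->
  (forall (a : k) x y, a *: mul x y = mul x (a *: y)) ->
  leavitt_family mul p q qs ->
  exists f : leavitt -> A,
    ((forall (a : k) x y, f (a *: x + y) = a *: f x + f y) /\
     (forall x y, f (x * y) = mul (f x) (f y)) /\
     (forall v, f (lgenr (GV v)) = p v) /\
     (forall e, f (lgenr (GE e)) = q e) /\
     (forall e, f (lgenr (GS e)) = qs e)) /\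
    (forall f' : leavitt -> A,
      (forall (a : k) x y, f' (a *: x + y) = a *: f' x + f' y) ->
      (forall x y, f' (x * y) = mul (f' x) (f' y)) ->
      (forall v, f' (lgenr (GV v)) = p v) ->
      (forall e, f' (lgenr (GE e)) = q e) ->
      (forall e, f' (lgenr (GS e)) = qs e) ->
      forall x, f' x = f x).
Proof.
move=> mA mDl mDr sAl sAr [Hvv [Hvw [Hse [Her [Hrs [Hss [Hee [Hef Hsum]]]]]]]].
pose ev := fix ev (t : lterm k E) : A :=
  match t with
  | TGen (GV v) => p v
  | TGen (GE e) => q e
  | TGen (GS e) => qs e
  | TZero => 0
  | TOpp x => - ev x
  | TAdd x y => ev x + ev y
  | TScale a x => a *: ev x
  | TMul x y => mul (ev x) (ev y)
  end.
have evP x y : lcong x y -> ev x = ev y.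
  elim=> {x y} //=; try by [move=> *; congruence].
  - by move=> *; rewrite addrA.
  - by move=> *; rewrite addrC.
  - by move=> *; rewrite add0r.
  - by move=> *; rewrite addNr.
  - by move=> *; rewrite scalerA.
  - by move=> *; rewrite scale1r.
  - by move=> *; rewrite scalerDr.
  - by move=> *; rewrite scalerDl.
  - by move=> v /Hsum ->; symmetry; apply: (big_morph ev).
exists (fun x => ev (repr x)); split.
  have evpi t : ev (repr (\pi_leavitt t)) = ev t by apply/evP/lcong_repr.
  split=> [a x y|]; first by rewrite evpi /= evpi.
  by split=> [x y|]; [rewrite evpi | split=> [v|]; [|split=> e]; rewrite evpi].
move=> f' f'L f'M f'v f'e f's x.
have f'0 : f' 0 = 0.
  by apply: (addrI (f' 0)); have := f'L 1 0 0; rewrite !scale1r !addr0 => <-.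
have f'Z a y : f' (a *: y) = a *: f' y.
  by have := f'L a y 0; rewrite !addr0 f'0 addr0.
have f'D y z : f' (y + z) = f' y + f' z.
  by have := f'L 1 y z; rewrite !scale1r.
rewrite {1}(piK x); elim: (repr x) => {x} [[v|e|e]||x Hx|x Hx y Hy|a x Hx|x Hx y Hy] /=.
- exact: f'v.
- exact: f'e.
- exact: f's.
- exact: f'0.
- by rewrite pi_oppZ f'Z Hx scaleN1r.
- by rewrite pi_add f'D Hx Hy.
- by rewrite pi_scale f'Z Hx.
- by rewrite pi_mul f'M Hx Hy.
Qed.

Definition lgen_deg (g : lgen E) : int :=
  match g with GV _ => 0 | GE _ => 1 | GS _ => -1 end.

(* The homogeneous component of degree d of the grading determined by the
   degrees of the generators. *)
Inductive homogeneous : int -> leavitt -> Prop :=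
  | homog_gen g : homogeneous (lgen_deg g) (lgenr g)
  | homog0 d : homogeneous d 0
  | homogD d x y : homogeneous d x -> homogeneous d y -> homogeneous d (x + y)
  | homogZ d a x : homogeneous d x -> homogeneous d (a *: x)
  | homogM d d' x y :
      homogeneous d x -> homogeneous d' y -> homogeneous (d + d') (x * y).

End Leavitt.

Definition graded_morphism (k : fieldType) (E F : fgraph)
    (f : leavitt k E -> leavitt k F) : Prop :=
  forall (d : int) (x : leavitt k E), homogeneous d x -> homogeneous d (f x).

(* Main.v *)
Require Import Defs.
From HB Require Import structures.
From mathcomp Require Import all_boot all_order all_algebra.
From mathcomp Require Import boolp zify.

(** Write B for the adjacency matrix of the splice.  The graded Grothendieck
    group of L_n carries the class u = [L_n] of the free module, on which the
    grading shift acts by u -> n u; for the splice the vertices give classes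
    d_v with sum u, which the shift transforms by d -> B d.  The proof
    uses only the shadow of this invariant on one concrete module of the target.

    Let F be a graph with a loop l.  L(F) acts on the functions on the infinite
    walks of F: edges prepend, ghost edges delete the first edge.  Let V_m be
    the space of functions supported on sequences that are constantly l from
    index m on.  It is finite-dimensional, and a homogeneous element of degree
    d maps V_m to V_(m+d) once m is large ([homogeneous_shifts]).

    Let f : L(E) -> L(F) be a unital graded ring homomorphism, E without sinks.
    For large m the images of the vertices are orthogonal idempotents on V_m
    with sum the action of 1, and the Leavitt relations split the image of v on
    V_(m+1) into pieces, one for each edge from v to some w, each equivalent to
    the image of w on V_m.  So the ranks d_v(m) satisfy d(m+1) = A d(m), with A
    the adjacency matrix of E, and they add up to the rank r(m) of 1 on V_m
    ([graded_dimension_vectors]).  Here r(m) is positive and independent of f.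

    Both halves now follow from one fact ([no_common_target]): no F with a
    loop receives unital graded homomorphisms from both L_n and L(splice); for
    each half F is the target, which also has its identity map.  Indeed L_n would
    force r(m+1) = n r(m), while L(splice) gives d(m+1) = B d(m) with sum r(m).  Two
    consecutive instances of sum(B d) = n sum(d) give d_0 + d_2 = 0, so d_0 and
    d_2 vanish for all large m; then d_1 = 0 because d_0(m+1) = n d_0 + d_1, and
    r(m) = 0 ([splice_growth_contradiction]). *)

Set Implicit Arguments.
Unset Strict Implicit.
Unset Printing Implicit Defensive.

Import GRing.Theory.
Local Open Scope ring_scope.

(** * Ranks of idempotent matrices *)

Section IdempotentRank.
Variable k : fieldType.

(** Each of Q R and R Q factors through the other one: Q R = Q (R Q) R and
    R Q = R (Q R) Q. *)
Lemma mxrank_mulC_idem m n (Q : 'M[k]_(m, n)) (R : 'M[k]_(n, m)) :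
  Q *m (R *m Q) = Q -> \rank (Q *m R) = \rank (R *m Q).
Proof.
move=> QRQ; apply/eqP; rewrite eqn_leq; apply/andP; split.
  rewrite -{1}QRQ -mulmxA; apply: leq_trans (mxrankM_maxr _ _) _.
  exact: mxrankM_maxl.
rewrite -{1}QRQ !mulmxA -2!mulmxA; apply: leq_trans (mxrankM_maxr _ _) _.
by rewrite mulmxA; apply: mxrankM_maxl.
Qed.

(** The row spaces of P and Q meet trivially, since P fixes a common vector
    and also kills it; each of them lies in that of P + Q, because
    P = P (P + Q) and Q = Q (P + Q). *)
Lemma mxrank_add_orthogonal n (P Q : 'M[k]_n) :
  P *m P = P -> Q *m Q = Q -> P *m Q = 0 -> Q *m P = 0 ->
  \rank (P + Q)%R = (\rank P + \rank Q)%N.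
Proof.
move=> PP QQ PQ QP; rewrite -mxrank_disjoint_sum; last first.
  apply/eqP; rewrite -submx0; apply/rV_subP => w.
  rewrite sub_capmx => /andP[/submxP[u wP] /submxP[v wQ]].
  suff -> : w = 0 by apply: sub0mx.
  by rewrite wP -PP mulmxA -wP wQ -mulmxA QP mulmx0.
apply/eqP; rewrite eqn_leq; apply/andP; split; apply: mxrankS.
  exact: addmx_sub_adds.
rewrite addsmx_sub; apply/andP; split.
  by apply/submxP; exists P; rewrite mulmxDr PP PQ addr0.
by apply/submxP; exists Q; rewrite mulmxDr QQ QP add0r.
Qed.

Lemma mxrank_sum_orthogonal n (I : finType) (B : pred I) (P : I -> 'M[k]_n) :
  (forall i, P i *m P i = P i) -> (forall i j, i <> j -> P i *m P j = 0) ->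
  \rank (\sum_(i | B i) P i)%R = (\sum_(i | B i) \rank (P i))%N.
Proof.
move=> idem orth.
suff H r : uniq r ->
    \rank (\sum_(i <- r) P i)%R = (\sum_(i <- r) \rank (P i))%N.
  have := H [seq i <- index_enum I | B i].
  by rewrite filter_uniq ?index_enum_uniq // !big_filter; apply.
elim: r => [|i r IH /= /andP[ir ur]]; first by rewrite !big_nil mxrank0.
have ne j : j \in r -> i <> j by move=> jr ij; rewrite ij jr in ir.
rewrite !big_cons mxrank_add_orthogonal ?IH //.
- rewrite mulmx_suml; apply: eq_big_seq => j jr.
  rewrite mulmx_sumr (bigD1_seq j) //= idem big1 ?addr0 // => l lj.
  by apply: orth => jl; rewrite jl eqxx in lj.
- by rewrite mulmx_sumr big1_seq // => j /= /ne /orth.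
- by rewrite mulmx_suml big1_seq // => j /= /ne ij; apply: orth => /esym/ij.
Qed.
End IdempotentRank.

(** * The action on functions on infinite walks *)

Section PathSpace.
Variables (k : fieldType) (F : Defs.fgraph).

Local Notation edges := (nat -> edge F).
Local Notation fspace := (edges -> k).

(** Functions live on all sequences of edges, and the operators below vanish
    off the genuine walks; the unit of the algebra then acts as a projection
    instead of as the identity. *)
Definition walk (x : edges) : bool := `[< forall i, rng (x i) = src (x i.+1) >].
Definition scons (e : edge F) (x : edges) : edges :=
  fun i => if i is j.+1 then x j else e.
Definition stail (x : edges) : edges := fun i => x i.+1.

Lemma scons_stail x : scons (x 0%N) (stail x) = x.
Proof. by apply: funext => -[|i]. Qed.

Lemma walk_scons e x : walk (scons e x) = (rng e == src (x 0%N)) && walk x.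
Proof.
apply/asboolP/andP => [w | [/eqP e0 /asboolP w]]; last by case.
by split; [apply/eqP/(w 0%N) | apply/asboolP => i; apply: (w i.+1)].
Qed.

Lemma walk_stail x : walk x = (rng (x 0%N) == src (x 1%N)) && walk (stail x).
Proof. by rewrite -{1}(scons_stail x) walk_scons. Qed.

Definition act_gen (g : lgen F) (phi : fspace) : fspace :=
  match g with
  | GV v => fun x => if walk x && (src (x 0%N) == v) then phi x else 0
  | GE e => fun x => if walk x && (x 0%N == e) then phi (stail x) else 0
  | GS e => fun x => if walk (scons e x) then phi (scons e x) else 0
  end.

Fixpoint act_term (t : lterm k F) (phi : fspace) : fspace :=
  match t with
  | TGen g => act_gen g phi
  | TZero => fun _ => 0
  | TOpp s => fun x => - act_term s phi x
  | TAdd s t => fun x => act_term s phi x + act_term t phi x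
  | TScale a s => fun x => a * act_term s phi x
  | TMul s t => act_term s (act_term t phi)
  end.

Definition linop (T : fspace -> fspace) : Prop := forall a phi psi,
  T (fun x => a * phi x + psi x) = fun x => a * T phi x + T psi x.

Lemma act_term_lin t : linop (act_term t).
Proof.
move=> a; elim: t => [[v|e|e]||s IHs|s IHs t IHt|b s IHs|s IHs t IHt] phi psi;
  apply: funext => x /=; rewrite ?IHs ?IHt ?IHs //.
- by case: ifP; rewrite ?mulr0 ?addr0.
- by case: ifP; rewrite ?mulr0 ?addr0.
- by case: ifP; rewrite ?mulr0 ?addr0.
- by rewrite mulr0 addr0.
- by rewrite opprD mulrN.
- by rewrite mulrDr addrACA.
- by rewrite mulrDr mulrCA.
Qed.

Lemma linop_add T phi psi : linop T ->
  T (fun x => phi x + psi x) = fun x => T phi x + T psi x.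
Proof.
move=> linT; have := linT 1 phi psi.
rewrite (_ : (fun x => 1 * phi x + psi x) = fun x => phi x + psi x).
  by move=> ->; apply: funext => x; rewrite mul1r.
by apply: funext => x; rewrite mul1r.
Qed.

Lemma linop0 T : linop T -> T (fun=> 0) = fun=> 0.
Proof.
move=> linT; have := linT (-1) (fun=> 0) (fun=> 0).
rewrite (_ : (fun x : edges => -1 * 0 + 0) = fun=> 0 :> k).
  by move=> ->; apply: funext => x; rewrite mulN1r addNr.
by apply: funext => x; rewrite mulr0 addr0.
Qed.

Lemma linopZ T a phi : linop T -> T (fun x => a * phi x) = fun x => a * T phi x.
Proof.
move=> linT; have := linT a phi (fun=> 0); rewrite linop0 //.
rewrite (_ : (fun x => a * phi x + 0) = fun x => a * phi x).
  by move=> ->; apply: funext => x; rewrite addr0.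
by apply: funext => x; rewrite addr0.
Qed.

Lemma linop_sum T (I : Type) (r : seq I) (c : I -> k) (phi : I -> fspace) :
  linop T -> T (fun x => \sum_(i <- r) c i * phi i x) =
             fun x => \sum_(i <- r) c i * T (phi i) x.
Proof.
move=> linT; elim: r => [|i r IH].
  under eq_fun do rewrite big_nil.
  by rewrite linop0 //; apply: funext => x; rewrite big_nil.
under eq_fun do rewrite big_cons.
by rewrite linT IH; apply: funext => x; rewrite big_cons.
Qed.

Lemma act_term_sum (I : Type) (r : seq I) (P : pred I) (t : I -> lterm k F)
    phi x :
  act_term (\big[@TAdd k F/TZero]_(i <- r | P i) t i) phi x =
  \sum_(i <- r | P i) act_term (t i) phi x.
Proof. exact: (big_morph (fun t => act_term t phi x)). Qed.

(** The defining relations hold exactly.  In the sum relation, only the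
    term of the edge e = x 0 contributes to the value at a walk x. *)
Lemma act_term_lcong t t' : lcong t t' -> act_term t = act_term t'.
Proof.
move=> tt'; apply: funext => phi.
elim: tt' phi => {t t'} /=; try by [move=> *; congruence].
- by move=> x y _ IH phi; apply: funext => p; rewrite IH.
- by move=> x x' y y' _ IHx _ IHy phi; apply: funext => p; rewrite IHx IHy.
- by move=> a x y _ IH phi; apply: funext => p; rewrite IH.
- by move=> *; apply: funext => p; rewrite addrA.
- by move=> *; apply: funext => p; rewrite addrC.
- by move=> *; apply: funext => p; rewrite add0r.
- by move=> *; apply: funext => p; rewrite addNr.
- by move=> *; apply: funext => p; rewrite mulrA.
- by move=> *; apply: funext => p; rewrite mul1r.
- by move=> *; apply: funext => p; rewrite mulrDr.
- by move=> *; apply: funext => p; rewrite mulrDl.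
- by move=> x y z phi; rewrite linop_add //; apply: act_term_lin.
- by move=> a x y phi; rewrite linopZ //; apply: act_term_lin.
- by move=> v phi; apply: funext => p; case: ifP => // ->.
- move=> v w vw phi; apply: funext => p.
  by case: (walk p) => //=; case: eqP => // ->; case: eqP.
- move=> e phi; apply: funext => p.
  case: (walk p) => //=.
  by have [->|] := eqVneq (p 0%N) e; rewrite ?eqxx ?if_same.
- move=> e phi; apply: funext => p; case: ifP => // /andP[+ /eqP pe].
  by rewrite walk_stail pe eq_sym => /andP[-> ->].
- move=> e phi; apply: funext => p; rewrite walk_scons eq_sym.
  by case: (_ == _); case: (walk p).
- by move=> e phi; apply: funext => p; rewrite eqxx andbT; case: ifP => // ->.
- move=> e phi; apply: funext => p; rewrite eqxx andbT walk_scons eq_sym andbC.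
  by case: ifP => // ->.
- move=> e f ef phi; apply: funext => p.
  by have [/ef//|_] := eqVneq e f; rewrite andbF if_same.
- move=> v _ phi; apply: funext => p; rewrite act_term_sum /=.
  have [wp|wp] := boolP (walk p); last by rewrite big1 // => e _.
  rewrite andTb big_mkcond (bigD1 (p 0%N)) //= big1 => [|e /negPf pe].
    by rewrite eqxx scons_stail wp addr0.
    by rewrite (eq_sym (p _)) pe if_same.
Qed.

Definition act (a : leavitt k F) : fspace -> fspace := act_term (repr a).

Lemma act_pi t : act (\pi_(leavitt k F)%qT t) = act_term t.
Proof. exact/act_term_lcong/lcong_repr. Qed.

Lemma act_lin a : linop (act a).
Proof. exact: act_term_lin. Qed.

Lemma act_genE g : act (lgenr k g) = act_gen g.
Proof. by rewrite act_pi. Qed.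

Lemma act0 phi x : act 0 phi x = 0.
Proof. by rewrite act_pi. Qed.

Lemma actD a b phi x : act (a + b) phi x = act a phi x + act b phi x.
Proof. by rewrite act_pi. Qed.

Lemma actZ c a phi x : act (c *: a) phi x = c * act a phi x.
Proof. by rewrite act_pi. Qed.

Lemma actM a b phi : act (a * b) phi = act a (act b phi).
Proof. by rewrite act_pi. Qed.

Lemma act_sum (I : Type) (r : seq I) (P : pred I) (a : I -> leavitt k F) phi x :
  act (\sum_(i <- r | P i) a i) phi x = \sum_(i <- r | P i) act (a i) phi x.
Proof.
exact: (big_morph (fun a => act a phi x)
  (fun a b => actD a b phi x) (act0 phi x)).
Qed.

Lemma act1 phi x : act 1 phi x = if walk x then phi x else 0.
Proof.
rewrite leavitt_oneE act_sum; under eq_bigr do rewrite act_genE /=.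
case: (walk x) => /=; last by rewrite big1.
rewrite (bigD1 (src (x 0%N))) //= eqxx big1 ?addr0 // => v.
by rewrite eq_sym => /negPf ->.
Qed.

(** * The finite-dimensional pieces *)

Variable l : edge F.

Definition supp (m : nat) (phi : fspace) : Prop :=
  forall x i, phi x != 0 -> (m <= i)%N -> x i = l.

Definition shifts (a : leavitt k F) (m m' : nat) : Prop :=
  forall phi, supp m phi -> supp m' (act a phi).

(** Small m must be excluded: a ghost edge cannot shorten a prefix of length 0,
    and in a product the intermediate index must stay nonnegative and beyond
    the threshold of the left factor. *)
Lemma homogeneous_shifts d a : homogeneous d a ->
  exists N, forall m m', (N <= m)%N -> m'%:Z = m%:Z + d -> shifts a m m'.
Proof.
elim=> {d a} [g|d|d a b _ [N Na] _ [N' Nb]|d c a _ [N Na]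
  |d d' a b _ [N Na] _ [N' Nb]].
- exists 1%N => m m' m1 mm' phi sphi x i; rewrite act_genE.
  case: g mm' => [v|e|e] /= mm'; case: ifP; rewrite ?eqxx // => wx px mi.
  + by apply: sphi px _; lia.
  + by case: i mi => [|i] mi; [lia | apply: (sphi _ i px); lia].
  + by apply: (sphi _ i.+1 px); lia.
- by exists 0%N => m m' _ _ phi _ x i; rewrite act0 eqxx.
- exists (maxn N N') => m m' Nm mm' phi sphi x i; rewrite actD => abx mi.
  have [a0|ax] := eqVneq (act a phi x) 0; last first.
    by apply: (Na m m' _ mm' phi sphi x i ax mi); lia.
  rewrite a0 add0r in abx.
  by apply: (Nb m m' _ mm' phi sphi x i abx mi); lia.
- exists N => m m' Nm mm' phi sphi x i.
  rewrite actZ mulf_eq0 negb_or => /andP[_ ax].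
  exact: (Na m m' Nm mm' phi sphi).
- exists (N' + N + `|d'|)%N => m m' Nm mm' phi sphi; rewrite actM.
  (* The index of the piece reached by b. *)
  pose j := `|(m%:Z + d')%R|%N.
  apply: (Na j); [lia | lia |].
  by apply: (Nb m); [lia | lia |].
Qed.

Definition ext m (t : m.-tuple (edge F)) : edges := nth l t.
Definition delta m (t : m.-tuple (edge F)) : fspace :=
  fun x => `[< x = ext t >]%:R.

Lemma ext_inj m : injective (@ext m).
Proof.
move=> t u tu; apply/val_inj/(@eq_from_nth _ l); rewrite ?size_tuple // => i _.
exact: (congr1 (@^~ i) tu).
Qed.

Lemma supp_delta m (t : m.-tuple _) : supp m (delta t).
Proof.
move=> x i; rewrite /delta; case: asboolP => [-> _ mi|]; last by rewrite eqxx.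
by rewrite /ext nth_default ?size_tuple.
Qed.

Lemma supp_expand m phi : supp m phi ->
  phi = fun x => \sum_(t : m.-tuple (edge F)) phi (ext t) * delta t x.
Proof.
move=> sphi; apply: funext => x.
have [[t ->]|nx] := pselect (exists t : m.-tuple (edge F), x = ext t).
  rewrite (bigD1 t) //= /delta; case: asboolP => // _.
  rewrite mulr1 big1 ?addr0 // => u ut.
  case: asboolP => [/ext_inj tu|]; rewrite ?mulr0 //.
  by rewrite tu eqxx in ut.
rewrite big1 => [|t _]; last first.
  rewrite /delta; case: asboolP => [xt|]; rewrite ?mulr0 //.
  by case: nx; exists t.
apply/eqP; apply: contrapT => /negP px; apply: nx.
exists (mktuple (fun i : 'I_m => x i)); apply: funext => i; rewrite /ext.
have [im|mi] := ltnP i m; last by rewrite nth_default ?size_tuple // (sphi x).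
by rewrite -[i]/(nat_of_ord (Ordinal im)) -tnth_nth tnth_mktuple.
Qed.

Definition level m := #|{: m.-tuple (edge F)}|.

(** The coordinates of an image are its values at the points [ext t].  They
    determine it only if it lies in V_m', hence the hypothesis of [act_mxM]. *)
Definition act_mx m m' (a : leavitt k F) : 'M[k]_(level m', level m) :=
  \matrix_(i, j) act a (delta (enum_val j)) (ext (enum_val i)).

Lemma act_mxM m m' m'' a b : shifts b m m' ->
  act_mx m m'' (a * b) = act_mx m' m'' a *m act_mx m m' b.
Proof.
move=> sb; apply/matrixP => i j; rewrite !mxE actM.
rewrite (supp_expand (sb _ (@supp_delta m (enum_val j)))) linop_sum;
  last exact: act_lin.
rewrite (reindex (fun i : 'I_(level m') => enum_val i)) /=;
  last exact/onW_bij/enum_val_bij.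
by apply: eq_bigr => u _; rewrite !mxE mulrC.
Qed.

Lemma act_mx_sum m m' (I : Type) (r : seq I) (P : pred I)
    (a : I -> leavitt k F) :
  act_mx m m' (\sum_(i <- r | P i) a i) = \sum_(i <- r | P i) act_mx m m' (a i).
Proof.
apply/matrixP => i j; rewrite !mxE act_sum summxE.
by apply: eq_bigr => u _; rewrite mxE.
Qed.

Lemma act_mx0 m m' : act_mx m m' 0 = 0.
Proof. by apply/matrixP => i j; rewrite !mxE act0. Qed.

(** The unit fixes the indicator function of the constant sequence l, a walk
    because l is a loop. *)
Lemma act_mx1_rank_gt0 m : rng l = src l -> (0 < \rank (act_mx m m 1%R))%N.
Proof.
move=> ll; rewrite lt0n mxrank_eq0; apply/eqP => /matrixP H.
pose t : m.-tuple (edge F) := nseq_tuple m l.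
have extl i : ext t i = l by rewrite /ext nth_nseq if_same.
move: (H (enum_rank t) (enum_rank t)); rewrite !mxE !enum_rankK act1.
rewrite (_ : walk (ext t)); last by apply/asboolP => i; rewrite !extl.
by rewrite /delta; case: asboolP => // _ /eqP; rewrite oner_eq0.
Qed.

(** * Dimension vectors of graded homomorphisms *)

Lemma eventually_forall (I : finType) (P : I -> nat -> Prop) :
  (forall i, exists N, forall m, (N <= m)%N -> P i m) ->
  exists N, forall i m, (N <= m)%N -> P i m.
Proof.
move=> /choice[N NP]; exists (\max_i N i) => i m Nm.
by apply: NP; apply: leq_trans (leq_bigmax i) Nm.
Qed.

Variable E : Defs.fgraph.

(** d_v(m) is the rank of f(v) on V_m.  Let Q and R be the matrices by which the
    images of an edge e and of its ghost act between V_m and V_(m+1).  The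
    vertex v acts on V_(m+1) as the sum of the orthogonal idempotents Q R over
    the edges e leaving v, and Q R has the same rank as R Q, which is the action
    of the range of e on V_m. *)
Theorem graded_dimension_vectors (f : {rmorphism leavitt k E -> leavitt k F}) :
  graded_morphism f -> (forall v : vertex E, ~ is_sink v) ->
  exists (N : nat) (d : nat -> vertex E -> nat), forall m, (N <= m)%N ->
    (forall v, d m.+1 v = \sum_(w : vertex E) adjacency v w * d m w)%N /\
    (\sum_v d m v)%N = \rank (act_mx m m 1%R).
Proof.
move=> fgr nosink.
have gr g := homogeneous_shifts (fgr _ _ (homog_gen k g)).
pose fg g := f (lgenr k g).
have [N1 N1P] : exists N, forall v m, (N <= m)%N -> shifts (fg (GV v)) m m.
  apply: (@eventually_forall _ (fun v m => shifts (fg (GV v)) m m)) => v.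
  by have [N NP] := gr (GV v); exists N => m Nm; apply: NP; rewrite ?addr0.
have [N2 N2P] : exists N, forall e m, (N <= m)%N -> shifts (fg (GE e)) m m.+1.
  apply: (@eventually_forall _ (fun e m => shifts (fg (GE e)) m m.+1)) => e.
  by have [N NP] := gr (GE e); exists N => m Nm; apply: NP => //=; lia.
have [N3 N3P] : exists N, forall e m, (N <= m)%N -> shifts (fg (GS e)) m.+1 m.
  apply: (@eventually_forall _ (fun e m => shifts (fg (GS e)) m.+1 m)) => e.
  by have [N NP] := gr (GS e); exists N => m Nm; apply: NP => /=; lia.
have [vv [vw [_ [er [_ [_ [ee [ef sumv]]]]]]]] := leavitt_gen_family k E.
pose P m v := act_mx m m (fg (GV v)).
exists (N1 + N2 + N3)%N, (fun m v => \rank (P m v)) => m Nm; split=> [v|].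
  pose Q e := act_mx m m.+1 (fg (GE e)).
  pose R e := act_mx m.+1 m (fg (GS e)).
  have QR e : act_mx m.+1 m.+1 (f (lgenr k (GE e) * lgenr k (GS e))) =
      Q e *m R e.
    by rewrite rmorphM; apply: act_mxM; apply: N3P; lia.
  have RQ e e' : act_mx m m (f (lgenr k (GS e) * lgenr k (GE e'))) =
      R e *m Q e'.
    by rewrite rmorphM; apply: act_mxM; apply: N2P; lia.
  (* The relations of the generators are stated with the bare product lmul;
     the patterns match it with the ring product up to conversion. *)
  have RQe e : R e *m Q e = P m (rng e) by rewrite -RQ [_ * _]ee.
  have RQ0 e e' : e <> e' -> R e *m Q e' = 0.
    by move=> ee'; rewrite -RQ [_ * _]ef // rmorph0 act_mx0.
  have QP e : Q e *m P m (rng e) = Q e.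
    by rewrite -act_mxM; [rewrite -rmorphM [_ * _]er | apply: N1P; lia].
  have -> : P m.+1 v = \sum_(e | src e == v) Q e *m R e.
    rewrite /P /fg [lgenr _ _]sumv // rmorph_sum act_mx_sum.
    by apply: eq_bigr => e _; rewrite -QR.
  rewrite mxrank_sum_orthogonal; first last.
  - by move=> e e' /RQ0 ee'; rewrite mulmxA -(mulmxA (Q e)) ee' mulmx0 mul0mx.
  - by move=> e; rewrite mulmxA -(mulmxA (Q e)) RQe QP.
  transitivity (\sum_(e | src e == v) \rank (P m (rng e)))%N.
    by apply: eq_bigr => e _; rewrite mxrank_mulC_idem RQe.
  rewrite (partition_big (@rng E) xpredT) //=; apply: eq_bigr => w _.
  rewrite (eq_bigr (fun=> \rank (P m w))) => [|e /andP[_ /eqP ->] //].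
  by rewrite sum_nat_const /adjacency cardsE.
have -> : act_mx m m 1 = \sum_v P m v.
  by rewrite -(rmorph1 f) leavitt_oneE rmorph_sum act_mx_sum.
have PM v w : P m v *m P m w = act_mx m m (f (lgenr k (GV v) * lgenr k (GV w))).
  by rewrite rmorphM -act_mxM //; apply: N1P; lia.
rewrite mxrank_sum_orthogonal // => [v|v w /vw vw0].
  by rewrite PM [_ * _]vv.
by rewrite PM [_ * _]vw0 rmorph0 act_mx0.
Qed.

End PathSpace.

(** * The contradiction *)

(** Substituting the recursion in the equation between sums at m gives
    a + 3b + 2c = n (b + c), and at m+1 gives 3a + 6b + 5c = 2n (b + c); the
    second minus twice the first is a + c = 0. *)
Lemma splice_growth_contradiction (n : nat) (a b c : nat -> nat) :
  (forall m, a m.+1 = n * a m + b m)%N ->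
  (forall m, b m.+1 = a m + b m + c m)%N ->
  (forall m, c m.+1 = b m + c m)%N ->
  (forall m, a m.+1 + b m.+1 + c m.+1 = n * (a m + b m + c m))%N ->
  (forall m, 0 < a m + b m + c m)%N -> False.
Proof.
move=> aS bS cS sS s_gt0.
have ac0 m : (a m = 0 /\ c m = 0)%N.
  have := sS m.+1; have := sS m.
  rewrite !(aS, bS, cS) !mulnDr; lia.
have [[a0 c0] [a1 _]] := (ac0 0%N, ac0 1%N).
by have := s_gt0 0%N; have := aS 0%N; lia.
Qed.

(** The rank of the unit on V_m is a single sequence r, read off both f and g:
    f makes it grow by the factor n, g writes it as the sum of a vector that
    evolves by the splice matrix. *)
Lemma no_common_target k n F (l : edge F)
    (f : {rmorphism leavitt k (rose n) -> leavitt k F})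
    (g : {rmorphism leavitt k (rose_splice n) -> leavitt k F}) :
  (1 <= n)%N -> rng l = src l ->
  graded_morphism f -> graded_morphism g -> False.
Proof.
move=> n1 ll fgr ggr.
have nosinkf (v : vertex (rose n)) : ~ is_sink v.
  by case: v => /(_ (Ordinal n1)).
have nosinkg (v : vertex (rose_splice n)) : ~ is_sink v.
  (* Every vertex has an edge to the middle one. *)
  have : (0 < @adjacency (rose_splice n) v (inord 1))%N.
    rewrite [adjacency _ _]adjacency_graph_of_adj mxE inordK //.
    by case: v => -[|[|[|]]].
  by move=> /card_gt0P[e]; rewrite inE => /andP[/eqP ev _] /(_ e).
have [N [c Hc]] := graded_dimension_vectors l fgr nosinkf.
have [N' [d Hd]] := graded_dimension_vectors l ggr nosinkg.
pose r m := \rank (act_mx l m m (1 : leavitt k F)).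
have r0 m : (0 < r m)%N by apply: act_mx1_rank_gt0.
have rn m : (N <= m)%N -> r m.+1 = (n * r m)%N.
  move=> Nm; have [cS cm] := Hc m Nm; have [_ cm1] := Hc m.+1 (leqW Nm).
  rewrite /r -cm -cm1 !(big_pred1 tt) => [|[]|[]] //.
  rewrite cS (big_pred1 tt) => [|[]] //.
  by rewrite /adjacency (_ : [set _ | _] = setT) ?cardsT ?card_ord.
pose D (i : nat) m := d m (inord i : 'I_3).
have dS m : (N' <= m)%N ->
  [/\ D 0 m.+1 = n * D 0 m + D 1 m, D 1 m.+1 = D 0 m + D 1 m + D 2 m,
      D 2 m.+1 = D 1 m + D 2 m & D 0 m + D 1 m + D 2 m = r m]%N.
  move=> Nm; have [dS dm] := Hd m Nm; rewrite /r -dm.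
  have dB v : d m.+1 v = (\sum_(w < 3) cuntz_splice_matrix n v w * d m w)%N.
    rewrite dS; apply: eq_bigr => w _; congr (_ * _)%N.
    exact: adjacency_graph_of_adj.
  have sum3 (h : 'I_3 -> nat) :
      (\sum_(w < 3) h w = h (inord 0) + h (inord 1) + h (inord 2))%N.
    rewrite !big_ord_recr big_ord0 /= add0n.
    by congr (h _ + h _ + h _)%N; apply: val_inj; rewrite /= inordK.
  rewrite /D !dB !sum3 !mxE !inordK //=.
  by split; lia.
pose M := (N + N')%N.
apply: (@splice_growth_contradiction n (fun i => D 0%N (M + i)%N)
  (fun i => D 1%N (M + i)%N) (fun i => D 2%N (M + i)%N)) => i; rewrite ?addnS.
- by have [-> _ _ _] := dS (M + i)%N ltac:(lia).
- by have [_ -> _ _] := dS (M + i)%N ltac:(lia).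
- by have [_ _ -> _] := dS (M + i)%N ltac:(lia).
- have [_ _ _ ->] := dS (M + i)%N ltac:(lia).
  have [_ _ _ ->] := dS (M + i).+1 ltac:(lia).
  by apply: rn; lia.
- by have [_ _ _ ->] := dS (M + i)%N ltac:(lia).
Qed.

(** Apart from f, the other map to the target is the identity; the loop is one
    at the middle vertex of the splice, respectively one of the n loops. *)
Theorem corollary4p2 (k : fieldType) (n : nat) (hn : (1 <= n)%N) :
  (~ exists f : {rmorphism leavitt k (rose n) -> leavitt k (rose_splice n)},
       graded_morphism f) /\
  (~ exists f : {rmorphism leavitt k (rose_splice n) -> leavitt k (rose n)},
       graded_morphism f).
Proof.
split=> -[f fgr].
  have : (0 < @adjacency (rose_splice n) (inord 1) (inord 1))%N.
    by rewrite [adjacency _ _]adjacency_graph_of_adj mxE inordK.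
  move=> /card_gt0P[l]; rewrite inE => /andP[/eqP sl /eqP rl].
  by apply: (@no_common_target k n _ l f idfun) => //; rewrite sl.
exact: (@no_common_target k n (rose n) (Ordinal hn) idfun f hn erefl
  (fun _ _ => id) fgr).
Qed.
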